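(* Let $\Gamma$ be an embedded (ribbon) graph and let $a,b$ be two distinct edges of $\Gamma$ such that an end of $a$ and an end of $b$ are neighbors in the cyclic order at some vertex. Let $\Gamma'_{ab}$ be the ribbon graph obtained from $\Gamma$ by exchanging these two neighboring ends. Then $D(\Gamma'_{ab})=D(\Gamma)'_{ab}$.
   Context: An embedded (ribbon) graph is a connected graph cellularly embedded in a compact surface, orientable or not (edges are ribbons; loops may be orientable or half-twisted). Its delta-matroid is $D(\Gamma)=(E(\Gamma);\Phi(\Gamma))$, where $\phi\subseteq E(\Gamma)$ is feasible iff the spanning ribbon subgraph with all vertices of $\Gamma$ and edge set $\phi$ has boundary consisting of exactly one connected component. For a set system $D=(E;\Phi)$ and distinct $a,b\in E$: the twist is $D*E'=(E;\{\phi\Delta E'\mid\phi\in\Phi\})$; the sliding of $a$ over $b$ is $\widetilde D_{ab}=(E;\Phi\,\Delta\,\{\phi\sqcup\{a\}\mid\phi\subseteq E\setminus\{a,b\},\ \phi\sqcup\{b\}\in\Phi\})$; and $D'_{ab}=\big(\widetilde{(D*\{b\})}_{ab}\big)*\{b\}$. *)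

(* Defs.v *)
From mathcomp Require Import all_boot all_fingroup.
Set Implicit Arguments.
Unset Strict Implicit.
Unset Printing Implicit Defensive.

(* Ribbon graphs as signed rotation systems.
   Half-edges (ends of edges) are pairs (e, b) : E * bool (the two ends of e).
   - rg_inc h : the vertex at which the end h is attached;
   - rg_rot   : the cyclic order of ends around each vertex (its cycles are the
                vertices' rotations, w.r.t. a chosen local orientation);
   - rg_tw e  : true iff the ribbon of e is half-twisted (w.r.t. the local
                orientations of its end vertices).                              *)
Record ribbon_graph (V E : finType) := RibbonGraph {
  rg_inc : E * bool -> V;
  rg_rot : {perm (E * bool)};
  rg_tw  : E -> bool
}.

Definition opp_end (E : finType) (h : E * bool) : E * bool := (h.1, ~~ h.2).

Definition rg_adj (V E : finType) (G : ribbon_graph V E) : rel V :=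
  fun u v => [exists e : E, (rg_inc G (e, false) == u) && (rg_inc G (e, true) == v)
                         || (rg_inc G (e, true) == u) && (rg_inc G (e, false) == v)].

Definition rg_wf (V E : finType) (G : ribbon_graph V E) : Prop :=
  [/\ forall h, rg_inc G (rg_rot G h) = rg_inc G h,
      forall h h', rg_inc G h = rg_inc G h' -> fconnect (rg_rot G) h h'
    & forall u v : V, connect (rg_adj G) u v].

(* Spanning ribbon subgraph with edge set phi: the rotation restricted to the
   ends of edges in phi ("next end in phi" in direction r). *)
Definition skip (E : finType) (r : E * bool -> E * bool) (phi : {set E}) (h : E * bool) :=
  iter (find (fun i => (iter i.+1 r h).1 \in phi) (iota 0 #|{: E * bool}|)).+1 r h.

(* Face-tracing permutation on (end, local direction) states of the spanning
   subgraph (identity on states of ends not in phi). *)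
Definition face_step (V E : finType) (G : ribbon_graph V E) (phi : {set E})
    (x : (E * bool) * bool) : (E * bool) * bool :=
  if x.1.1 \in phi then
    let s := x.2 (+) rg_tw G x.1.1 in
    (skip (if s then (fun h => (rg_rot G)^-1%g h) else (fun h => rg_rot G h))
          phi (opp_end x.1), s)
  else x.

Definition states (E : finType) (phi : {set E}) : {set (E * bool) * bool} :=
  [set x | x.1.1 \in phi].

(* Number of boundary components of the spanning ribbon subgraph (V, phi):
   each isolated vertex contributes one component; every other boundary
   component is traced exactly twice (once in each direction) by face_step. *)
Definition n_boundary (V E : finType) (G : ribbon_graph V E) (phi : {set E}) : nat :=
  #|[set v : V | [forall h : E * bool, (h.1 \in phi) ==> (rg_inc G h != v)]]|
  + (fcard (face_step G phi) (states phi))./2.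

Definition feasible (V E : finType) (G : ribbon_graph V E) : {set {set E}} :=
  [set phi : {set E} | n_boundary G phi == 1].

Definition exchange_ends (V E : finType) (G : ribbon_graph V E) (ha hb : E * bool) :=
  RibbonGraph (rg_inc G) (rg_rot G ^ tperm ha hb)%g (rg_tw G).

Definition symdiff (T : finType) (A B : {set T}) : {set T} := (A :\: B) :|: (B :\: A).

Definition ss_twist (E : finType) (Phi : {set {set E}}) (X : {set E}) : {set {set E}} :=
  [set symdiff phi X | phi in Phi].

Definition ss_slide (E : finType) (Phi : {set {set E}}) (a b : E) : {set {set E}} :=
  symdiff Phi [set phi :|: [set a] | phi in
                 [set phi : {set E} | (phi \subset ~: [set a; b]) && ((phi :|: [set b]) \in Phi)]].

Definition ss_prime (E : finType) (Phi : {set {set E}}) (a b : E) : {set {set E}} :=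
  ss_twist (ss_slide (ss_twist Phi [set b]) a b) [set b].

(* Main.v *)
Require Import Defs.
From mathcomp Require Import all_boot all_fingroup.

Set Implicit Arguments.
Unset Strict Implicit.
Unset Printing Implicit Defensive.

(* The boundary of the spanning ribbon subgraph with edge set phi is the union of
   the orbits of two fixed-point-free involutions on the sides of all ends of
   edges: k pairs the two sides of each corner at a vertex, and b_phi pairs the
   sides along the edges of phi, or the two sides of each end of an edge outside
   phi. So phi is feasible iff k and b_phi act transitively together.

   Exchanging ha and hb conjugates k, or equivalently b_phi, by the swap tau of
   their sides. The involutions b_phi, tau b_phi tau and b_(phi - {a,b}) agree
   outside the 8 sides of the ends of a and b, and there k and b_phi link these 8
   sides by paths, i.e. by a perfect matching m that joins the two sides of the
   corner between ha and hb. Apart from the condition, common to all three,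
   that every orbit meets these sides, transitivity depends on m only. When a and
   b are in phi, contracting that corner turns the three involutions into three
   disjoint perfect matchings of a K_(3,3), and every perfect matching of the 6
   points forms a Hamiltonian cycle with an even number of them. *)

(** * Orbits of a pair of involutions *)

Lemma connect_ind (T : finType) (e : rel T) (P : T -> Prop) (x : T) :
  P x -> (forall y z, P y -> e y z -> P z) -> forall y, connect e x y -> P y.
Proof.
move=> Px step y /connectP [p]; elim: p x Px => [|z p IHp] x Px /=.
  by move=> _ ->.
by case/andP=> xz; apply: IHp; apply: step xz.
Qed.

Definition gen_rel (T : eqType) (k b : T -> T) : rel T :=
  [rel x y | (y == k x) || (y == b x)].

Definition transitive2 (T : finType) (k b : T -> T) : bool :=
  [forall x, forall y, connect (gen_rel k b) x y].

Section TwoInvolutions.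

Variables (T : finType) (k b : T -> T).
Hypotheses (kK : involutive k) (bK : involutive b).

Let g x := k (b x).

Let gE x : g x = k (b x).
Proof. by []. Qed.

Lemma gen_rel_l x : connect (gen_rel k b) x (k x).
Proof. by apply: connect1; rewrite /gen_rel /= eqxx. Qed.

Lemma gen_rel_r x : connect (gen_rel k b) x (b x).
Proof. by apply: connect1; rewrite /gen_rel /= eqxx orbT. Qed.

Lemma gen_rel_sym : connect_sym (gen_rel k b).
Proof.
by apply: sym_connect_sym => x y; rewrite /gen_rel /=;
  congr orb; apply/eqP/eqP => ->; rewrite ?kK ?bK.
Qed.

Lemma comp_inj : injective g.
Proof. by move=> x y /(inv_inj kK) /(inv_inj bK). Qed.

(** Both involutions invert [g] by conjugation, as reflections do in a dihedral group:
    [b g b = g^-1], hence [g^n b g^n = b]. *)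
Lemma iter_comp_r n x : iter n g (b (iter n g x)) = b x.
Proof.
elim: n => // n IHn; rewrite iterSr iterS -[RHS]IHn.
by congr (iter n g _); rewrite !gE bK kK.
Qed.

Lemma iter_comp_l n x : iter n g (k (iter n g x)) = k x.
Proof.
elim: n => // n IHn; rewrite iterSr iterS -[RHS]IHn.
by congr (iter n g _); rewrite !gE kK bK.
Qed.

Lemma iter_comp_inj n : injective (iter n g).
Proof. by elim: n => // n IHn x y /comp_inj /IHn. Qed.

Lemma fconnect_gen_rel x y : fconnect g x y -> connect (gen_rel k b) x y.
Proof.
move: y; apply: connect_ind => // y z xy /eqP <-.
exact: connect_trans xy (connect_trans (gen_rel_r _) (gen_rel_l _)).
Qed.

(** A dihedral orbit is the union of the two orbits of its rotations [g] through [x] and [b x]. *)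
Lemma connect_gen_rel x y :
  connect (gen_rel k b) x y = fconnect g x y || fconnect g (b x) y.
Proof.
apply/idP/orP; last first.
  case=> /fconnect_gen_rel // bxy; exact: connect_trans (gen_rel_r _) bxy.
have flip u v : fconnect g u v -> fconnect g (b u) (b v).
  move=> uv; rewrite (fconnect_sym comp_inj) -(iter_findex uv).
  by rewrite -[X in fconnect _ _ X](iter_comp_r (findex g u v)) fconnect_iter.
move: y; apply: connect_ind => [|y z]; first by left; apply: connect0.
have kE u v : fconnect g u (b v) -> fconnect g u (k v).
  by move=> /connect_trans; apply; rewrite -[X in k X]bK fconnect1.
by case=> xy /orP[] /eqP ->; [right; apply: kE| right| left; apply: kE| left];
  move/flip: xy; rewrite ?bK.
Qed.

Hypothesis k_free : forall x, k x != x.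

(** If [g^i x = b x], the middle of the way is a fixed point: [b] fixes [g^j x] when [i = 2j], and
    [k] fixes [g^(j+1) x] when [i = 2j+1]. *)
Lemma fconnect_comp_free x :
  (forall y, fconnect g x y -> b y != y) -> ~~ fconnect g x (b x).
Proof.
move=> b_free; apply/negP => /iter_findex; set i := findex _ _ _.
rewrite -(odd_double_half i) -addnn; case: (odd i) => [ibx|]; last first.
  rewrite add0n iterD -[RHS](iter_comp_r i./2) => /iter_comp_inj /esym /eqP.
  by apply/negP/b_free/fconnect_iter.
have /eqP[] : k (iter (i./2).+1 g x) != iter (i./2).+1 g x by [].
apply: (@iter_comp_inj (i./2).+1).
by rewrite iter_comp_l -iterD addSn addnS iterS -add1n ibx gE bK.
Qed.

(** If [b] fixes [x], the orbit is a path starting at [x], with [k] and [b] alternating; half a turn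
    of [g] leads to its other end. *)
Definition mate (x : T) : T := iter (fingraph.order g x)./2 g x.

Section FixedPoint.

Variable s : T.
Hypothesis bs : b s = s.

(** For an odd order [2i+1], the point [g^(i+1) s] would be fixed by [k]. *)
Lemma even_order : ~~ odd (fingraph.order g s).
Proof.
apply/negP => odd_n; set i := (fingraph.order g s)./2.
have nE : fingraph.order g s = (i + i).+1 by rewrite -[LHS]odd_double_half odd_n -addnn.
have /eqP[] : k (iter i.+1 g s) != iter i.+1 g s by [].
apply: (@iter_comp_inj i.+1).
rewrite iter_comp_l -iterD addSn addnS -nE iterS (iter_order comp_inj).
by rewrite gE bs.
Qed.

Lemma order_mate : fingraph.order g s = (fingraph.order g s)./2 + (fingraph.order g s)./2.
Proof. by rewrite addnn -[LHS]odd_double_half (negbTE even_order). Qed.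

Lemma b_mate : b (mate s) = mate s.
Proof.
apply: (@iter_comp_inj (fingraph.order g s)./2).
by rewrite iter_comp_r /mate -iterD -order_mate (iter_order comp_inj).
Qed.

Lemma mate_neq : mate s != s.
Proof.
have h_gt0 : 0 < (fingraph.order g s)./2.
  have := fingraph.order_gt0 g s.
  by rewrite [X in 0 < X](order_mate); case: (_./2).
apply/eqP => ms; have h_lt : (fingraph.order g s)./2 < fingraph.order g s.
  by rewrite [X in _ < X]order_mate -[X in X < _]addn0 ltn_add2l.
have := findex_iter h_lt; rewrite -/(mate s) ms findex0 => h0.
by rewrite -h0 in h_gt0.
Qed.

Lemma connect_mate : connect (gen_rel k b) s (mate s).
Proof. exact/fconnect_gen_rel/fconnect_iter. Qed.

(** If [y = g^i s] is fixed by [b], then [g^(2i) s = s]. As [i] is less than the order, [2i] is 0 or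
    the order. *)
Lemma fixed_point_mate y : b y = y -> connect (gen_rel k b) s y ->
  (y == s) || (y == mate s).
Proof.
rewrite connect_gen_rel bs orbb => byy sy.
have i_lt := findex_max sy; move: (iter_findex sy) i_lt.
set i := findex _ _ _ => iy i_lt.
have: iter (i + i) g s = s.
  by rewrite iterD iy -{1}byy -{1}iy iter_comp_r bs.
case: (ltnP (i + i) (fingraph.order g s)) => [ii_lt iis | n_le].
  have := findex_iter ii_lt; rewrite iis findex0.
  by case: i iy {i_lt ii_lt iis} => // <- _; rewrite eqxx.
rewrite -(subnK n_le) iterD (iter_order comp_inj) => iis.
have d_lt : i + i - fingraph.order g s < fingraph.order g s.
  by rewrite ltn_subLR // -addSn leq_add // ltnW.
have := findex_iter d_lt; rewrite iis findex0 => /esym /eqP.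
rewrite subn_eq0 => le_n; have /eqP nE : i + i == fingraph.order g s by rewrite eqn_leq le_n.
by rewrite -iy /mate -nE addnn doubleK eqxx orbT.
Qed.

End FixedPoint.

Lemma mateK s : b s = s -> mate (mate s) = s.
Proof.
move=> bs; have bm := b_mate bs.
have ms : connect (gen_rel k b) (mate s) s.
  by rewrite gen_rel_sym; apply: connect_mate.
have /orP[/eqP sm | /eqP <- //] := fixed_point_mate bm bs ms.
by move: (mate_neq bs); rewrite -sm eqxx.
Qed.

End TwoInvolutions.

(** * Reducing transitivity to the ends of paths *)

Section Reduction.

Variables (T I : finType) (k b bs : T -> T) (e : I -> T) (b' : I -> I).
Hypotheses (kK : involutive k) (k_free : forall x, k x != x).
Hypotheses (bsK : involutive bs) (e_inj : injective e).
Hypothesis bs_e : forall i, bs (e i) = e i.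
Hypothesis bs_fixed : forall x, bs x = x -> exists i, x = e i.
Hypothesis b_e : forall i, b (e i) = e (b' i).
Hypothesis b_off : forall x, (forall i, x != e i) -> b x = bs x.

Definition mate_index (i : I) : I := odflt i [pick j | e j == mate k bs (e i)].

Lemma mate_indexE i : e (mate_index i) = mate k bs (e i).
Proof.
rewrite /mate_index; case: pickP => [j /eqP // | no_j].
have [j jE] := bs_fixed (b_mate kK bsK k_free (bs_e i)).
by have := no_j j; rewrite -jE eqxx.
Qed.

Lemma mate_indexK : involutive mate_index.
Proof. by move=> i; apply: e_inj; rewrite !mate_indexE mateK. Qed.

Lemma mate_index_free i : mate_index i != i.
Proof. by rewrite -(inj_eq e_inj) mate_indexE mate_neq. Qed.

Lemma connect_mate_index i j : connect (gen_rel k bs) (e i) (e j) ->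
  connect (gen_rel mate_index b') i j.
Proof.
move=> /(fixed_point_mate kK bsK (bs_e i) (bs_e j)).
rewrite -mate_indexE !(inj_eq e_inj) => /orP[]/eqP ->; first exact: connect0.
exact: gen_rel_l.
Qed.

Let codomP x : (exists i, x = e i) \/ (forall i, x != e i).
Proof.
case: (pickP (fun i => x == e i)) => [i /eqP|no_i]; first by left; exists i.
by right=> i; rewrite no_i.
Qed.

(** Along a walk from [e i], a step of [k], or of [b] off the points [e j], stays on the same path
    or cycle of [k] and [bs]; a step of [b] at a point [e j] is a step of [b']. *)
Lemma connect_reduction x i : connect (gen_rel k b) (e i) x ->
  exists2 j, connect (gen_rel k bs) x (e j) & connect (gen_rel mate_index b') i j.
Proof.
move: x; apply: connect_ind => [|y z [j yj ij]]; first by exists i.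
case/orP=> /eqP ->.
  exists j => //; apply: connect_trans yj.
  by rewrite gen_rel_sym //; apply: gen_rel_l.
have [[l yE]|off] := codomP y; last first.
  exists j => //; apply: connect_trans yj; rewrite b_off //.
  by rewrite gen_rel_sym //; apply: gen_rel_r.
exists (b' l); first by rewrite yE b_e.
apply: connect_trans (gen_rel_r mate_index b' l).
apply: connect_trans ij _; apply: connect_mate_index.
by rewrite -yE gen_rel_sym.
Qed.

(** The first factor involves only [k] and [bs], so it is shared by all [b] that agree off the
    points [e i]; only the second sees [b']. Walks from [e i0] show that every orbit of [k] and [bs]
    meets these points. *)
Lemma transitive2_reduction (i0 : I) : involutive b ->
  transitive2 k b = [forall x, exists i, connect (gen_rel k bs) x (e i)]
                    && transitive2 mate_index b'.
Proof.
move=> bK; apply/idP/andP=> [tr | [/forallP reach tr]].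
  have trP x y := forallP (forallP tr x) y.
  split; apply/forallP=> x.
    by apply/existsP; have [j xj _] := connect_reduction (trP (e i0) x); exists j.
  apply/forallP=> j; have [l jl xl] := connect_reduction (trP (e x) (e j)).
  apply: connect_trans xl _; apply: connect_mate_index.
  by rewrite gen_rel_sym.
have sub x y : connect (gen_rel k bs) x y -> connect (gen_rel k b) x y.
  move: y; apply: connect_ind => // y z xy /orP[] /eqP ->; apply: connect_trans xy _.
    exact: gen_rel_l.
  have [[l ->]|off] := codomP y; first by rewrite bs_e.
  by rewrite -b_off //; apply: gen_rel_r.
have lift i j : connect (gen_rel mate_index b') i j -> connect (gen_rel k b) (e i) (e j).
  move: j; apply: connect_ind => // j l ij /orP[] /eqP ->; apply: connect_trans ij _.
    by rewrite mate_indexE; apply: sub; apply: connect_mate.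
  by rewrite -b_e; apply: gen_rel_r.
apply/forallP=> x; apply/forallP=> y.
have [/existsP[i xi] /existsP[j yj]] := (reach x, reach y).
apply: connect_trans (sub _ _ xi) _; rewrite gen_rel_sym //.
apply: connect_trans (sub _ _ yj) _; apply: lift.
exact: (forallP (forallP tr j) i).
Qed.

End Reduction.

(** * The 8 sides of two edges and the exhaustive check *)

(* The sides of the ends of [a] and [b]: [(c, t, d)] is side [d] of an end of
   [a] ([c = false]) or [b] ([c = true]), namely of the end [ha] or [hb] that
   is exchanged if [t = false], and of the opposite end if [t = true]. *)
Definition octet : Type := bool * bool * bool.

Definition octet_side (p tw : bool -> bool) (x : octet) : octet :=
  let: (c, t, d) := x in
  if p c then (c, ~~ t, ~~ (d (+) tw c)) else (c, t, ~~ d).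

Definition octet_swap (x : octet) : octet :=
  let: (c, t, d) := x in (c (+) ~~ t, t, d).

Definition octets : seq octet :=
  [seq (ct.1, ct.2, d) | ct <- [seq (c, t) | c <- [:: false; true], t <- [:: false; true]],
                         d <- [:: false; true]].

Definition octet_code (x : octet) : nat :=
  let: (c, t, d) := x in c * 4 + t * 2 + d.

Definition octet0 : octet := (false, false, false).

Lemma mem_octets x : x \in octets.
Proof. by case: x => [[[] []] []]. Qed.

Lemma octet_code_lt x : octet_code x < 8.
Proof. by case: x => [[[] []] []]. Qed.

Lemma nth_octet_code x : nth octet0 octets (octet_code x) = x.
Proof. by case: x => [[[] []] []]. Qed.

Lemma octet_code_nth i : i < 8 -> octet_code (nth octet0 octets i) = i.
Proof. by do 8?[case: i => // i]. Qed.

(** Two perfect matchings of 8 points have alternating cycles of length at most 8, so four rounds of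
    [m] and [b] list the whole cycle of [octet0]. Its closure is checked by computation too, through
    [walk_closed]. *)
Definition walk (m b : octet -> octet) : seq octet :=
  flatten [seq [:: x; m x] | x <- traject (b \o m) octet0 4].

Definition walk_closed m b : bool :=
  all (fun x => (m x \in walk m b) && (b x \in walk m b)) (walk m b).

Definition walk_full m b : bool := all (mem (walk m b)) octets.

Lemma transitive2_walk m b : involutive m -> involutive b ->
  walk_closed m b -> transitive2 m b = walk_full m b.
Proof.
move=> mK bK /allP closed; have w0 : octet0 \in walk m b by rewrite inE eqxx.
apply/forallP/allP => [tr x _ | full x].
  move/forallP: (tr octet0) => /(_ x) /=.
  move: x; apply: connect_ind => // y z /closed /andP[my bY].
  by case/orP=> /eqP ->.
have reach y : connect (gen_rel m b) octet0 y.
  have /flatten_mapP[z /trajectP[i _ ->]] := full y (mem_octets y).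
  set z' := iter _ _ _; have cz' : connect (gen_rel m b) octet0 z'.
    rewrite {}/z'; elim: i => [|i IHi]; first exact: connect0.
    apply: connect_trans IHi (connect_trans (gen_rel_l m b _) (gen_rel_r m b _)).
  rewrite !inE => /orP[] /eqP -> //; apply: connect_trans cz' _; exact: gen_rel_l.
by apply/forallP=> y; apply: connect_trans (reach y); rewrite gen_rel_sym.
Qed.

(** A backtracking search, cut at the first prefix that fails [ok]. The explicit [if] keeps
    call-by-value evaluation out of the branches cut off. *)
Fixpoint all_tables (n : nat) (ok P : pred (seq octet)) (t : seq octet) : bool :=
  if n is n'.+1 then
    all (fun v => if ok (rcons t v) then all_tables n' ok P (rcons t v) else true) octets
  else P t.

Lemma all_tablesS n ok P t : all_tables n.+1 ok P t =
  all (fun v => if ok (rcons t v) then all_tables n ok P (rcons t v) else true) octets.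
Proof. by []. Qed.

Lemma all_tablesP (ok P : pred (seq octet)) (s t : seq octet) :
  (forall s', prefix s' (t ++ s) -> ok s') ->
  all_tables (size s) ok P t -> P (t ++ s).
Proof.
elim: s t => [|v s IHs] t okP; first by rewrite cats0.
rewrite [size _]/= all_tablesS.
rewrite -cat_rcons => /allP /(_ v (mem_octets v)).
rewrite okP; last by rewrite -cat_rcons prefix_prefix.
by apply: IHs => s'; rewrite cat_rcons; apply: okP.
Qed.

(* A prefix of the table of a fixed-point-free involution sending side 1 of
   [ha] to side 0 of [hb], its partner in the corner between them. *)
Definition matching_table (t : seq octet) : bool :=
  all (fun i => let j := octet_code (nth octet0 t i) in
    [&& j != i, (j < size t) ==> (octet_code (nth octet0 t j) == i)
      & (i == 1) ==> (j == 4)]) (iota 0 (size t)).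

Definition lookup (t : seq octet) (x : octet) : octet := nth octet0 t (octet_code x).

Definition of_pair (u v : bool) (c : bool) : bool := if c then v else u.

(** [b0], [b1] and [b2] stand for [phi], for [phi] after the exchange, and for [phi] without the two
    edges. The closure conditions ensure that [walk_full] decides transitivity. *)
Definition exchange_parity (m : octet -> octet) (p tw : bool -> bool) : bool :=
  let b0 := octet_side p tw in
  let b1 := octet_swap \o b0 \o octet_swap in
  let b2 := octet_side xpred0 tw in
  [&& walk_closed m b0, walk_closed m b1, walk_closed m b2 &
      walk_full m b0 (+) walk_full m b1
      == [&& p false, p true & walk_full m b2]].

Definition exchange_parity_all (m : octet -> octet) : bool :=
  let B := [:: false; true] in
  all (fun pa => all (fun pb => all (fun ta => all (fun tb =>
    exchange_parity m (of_pair pa pb) (of_pair ta tb)) B) B) B) B.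

(** The imposed pair leaves 15 matchings of the other 6 sides; each is tested with the 16 choices of
    membership and twist of the two edges. *)
Lemma exchange_parity_tables :
  all_tables 8 matching_table (exchange_parity_all \o lookup) [::].
Proof. by vm_compute. Qed.

Lemma eq_exchange_parity m m' p p' tw tw' : m =1 m' -> p =1 p' -> tw =1 tw' ->
  exchange_parity m p tw = exchange_parity m' p' tw'.
Proof.
move=> mE pE twE; rewrite /exchange_parity /walk_full /walk_closed.
have sE q q' : q =1 q' -> octet_side q tw =1 octet_side q' tw'.
  by move=> qE [[c t] d] /=; rewrite qE twE.
have wE b b' : b =1 b' -> walk m b = walk m' b'.
  by move=> bE; rewrite /walk /= !mE !bE.
have b1E : octet_swap \o octet_side p tw \o octet_swap
           =1 octet_swap \o octet_side p' tw' \o octet_swap.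
  by move=> x /=; rewrite (sE _ _ pE).
rewrite (wE _ _ (sE _ _ pE)) (wE _ _ (sE xpred0 xpred0 (frefl _))) (wE _ _ b1E) !pE.
congr [&& _, _, _ & _]; apply: eq_all => x; rewrite mE ?b1E ?(sE _ _ pE) //.
Qed.

Lemma exchange_parityP m p tw : involutive m -> (forall x, m x != x) ->
  m (false, false, true) = (true, false, false) -> exchange_parity m p tw.
Proof.
move=> mK m_free m1; pose s := map m octets.
have lookupE : lookup s =1 m.
  by move=> x; rewrite /lookup (nth_map octet0) ?octet_code_lt // nth_octet_code.
(* The table of [m] survives the pruning of the search at every length. *)
have okP s' : prefix s' s -> matching_table s'.
  move=> /prefixP[s'' sE]; apply/allP=> i; rewrite mem_iota add0n /= => i_lt.
  have s_lt j : j < size s' -> j < 8.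
    by move=> /leq_trans; apply; rewrite -[8]/(size s) sE size_cat leq_addr.
  have nthE j : j < size s' -> nth octet0 s' j = m (nth octet0 octets j).
    move=> j_lt; rewrite -(nth_map octet0 octet0) ?s_lt // -/s sE nth_cat j_lt //.
  rewrite /= nthE //; apply/and3P; split.
  - apply/eqP=> iE; have /eqP[] := m_free (nth octet0 octets i).
    by rewrite -[in RHS]iE nth_octet_code.
  - by apply/implyP=> j_lt; rewrite nthE // nth_octet_code mK octet_code_nth // s_lt.
  - by apply/implyP=> /eqP ->; rewrite m1.
have boolE c : c \in [:: false; true] by case: c.
have /allP/(_ (p false) (boolE _)) := all_tablesP (t := [::]) okP exchange_parity_tables.
move=> /allP/(_ (p true) (boolE _)) /allP/(_ (tw false) (boolE _)).
move=> /allP/(_ (tw true) (boolE _)).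
rewrite (@eq_exchange_parity _ m _ p _ tw) //; by case.
Qed.

(** * Flags and their two involutions *)

(* A flag [(h, d)] is a side of the end [h]: the one facing the next end around
   the vertex if [d = true], the one facing the previous end if [d = false].
   The state [(h, d)] of [face_step] is the flag at which the trace, moving
   around the vertex with direction [d], reaches [h]. *)
Definition corner (E : finType) (rot : {perm (E * bool)}) (x : (E * bool) * bool) :
    (E * bool) * bool :=
  if x.2 then (rot x.1, false) else ((rot^-1)%g x.1, true).

(** Along an untwisted ribbon, the side facing the next end at one foot faces the previous end at
    the other, hence the negation; a half-twist cancels it. *)
Definition side (E : finType) (phi : {set E}) (tw : E -> bool) (x : (E * bool) * bool) :
    (E * bool) * bool :=
  if x.1.1 \in phi then (opp_end x.1, ~~ (x.2 (+) tw x.1.1)) else (x.1, ~~ x.2).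

Lemma cornerK (E : finType) (rot : {perm (E * bool)}) : involutive (corner rot).
Proof. by case=> h [] /=; rewrite /corner /= ?permK ?permKV. Qed.

Lemma corner_free (E : finType) (rot : {perm (E * bool)}) x : corner rot x != x.
Proof. by case: x => h []; rewrite /corner -pair_eqE /= andbF. Qed.

Lemma sideK (E : finType) (phi : {set E}) tw : involutive (side phi tw).
Proof.
case=> [[e t] d]; rewrite /side /=; case ephi: (e \in phi); rewrite /= ephi /opp_end /= negbK //.
by case: d; case: (tw e).
Qed.

Lemma side_free (E : finType) (phi : {set E}) tw x : side phi tw x != x.
Proof.
case: x => [[e t] d]; rewrite /side /opp_end /=.
by case: ifP => _; rewrite -!pair_eqE /= -?pair_eqE /= ?eqxx; case: t; case: d.
Qed.

Lemma side_edge (E : finType) (phi : {set E}) tw x : (side phi tw x).1.1 = x.1.1.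
Proof. by rewrite /side; case: ifP. Qed.

(** * Boundary components as orbits of flags *)

Section FaceCount.

Variables (V E : finType) (G : ribbon_graph V E) (phi : {set E}).

Let k := corner (rg_rot G).
Let b := side phi (rg_tw G).
Let g x := k (b x).
Let F := face_step G phi.
Let A := states phi.
Let r := gen_rel k b.
Let kK : involutive k := cornerK (rg_rot G).
Let bK : involutive b := sideK phi (rg_tw G).

Lemma mem_states_side x : (b x \in A) = (x \in A).
Proof. by rewrite !inE side_edge. Qed.

(** The iterates of the injective [f] return to [h], whose edge is in [phi], within the range
    searched by [find]. *)
Lemma mem_skip (f : E * bool -> E * bool) h : injective f -> h.1 \in phi ->
  exists2 n, skip f phi h = iter n.+1 f h &
    (skip f phi h).1 \in phi /\ forall i, i < n -> (iter i.+1 f h).1 \notin phi.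
Proof.
move=> f_inj hphi; rewrite /skip; set p : pred nat := fun i => _ \in _; set s := iota _ _.
have has_p : has p s.
  apply/hasP; exists (fingraph.order f h).-1; rewrite ?mem_iota /p /=.
    by rewrite add0n prednK ?fingraph.order_gt0 // max_card.
  by rewrite -iterS prednK ?fingraph.order_gt0 // iter_order.
have find_lt : find p s < #|{: E * bool}| by rewrite -[X in _ < X](size_iota 0) -has_find.
exists (find p s) => //; split.
  by have := nth_find 0 has_p; rewrite nth_iota.
move=> i i_lt; have := before_find 0 i_lt.
by rewrite nth_iota ?add0n /p => [->|]; last exact: ltn_trans find_lt.
Qed.

(** [F] is the first-return map of [g] to [A]: the first [b] crosses the ribbon and fixes the
    direction [s]; the later steps of [g] turn around the vertex in that direction past ends outside
    [phi]. *)
Lemma face_step_return x : x \in A ->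
  exists2 n, F x = iter n.+1 g x &
    F x \in A /\ forall i, i < n -> iter i.+1 g x \notin A.
Proof.
rewrite /A inE /F /face_step => xphi; rewrite xphi; set s := _ (+) _.
set f := if s then _ else _.
have f_inj : injective f by rewrite /f; case: ifP => _; apply: perm_inj.
have [|n -> [in_phi out_phi]] := @mem_skip f (opp_end x.1) f_inj; first by [].
have iterE i : i <= n -> iter i.+1 g x = (iter i.+1 f (opp_end x.1), s).
  elim: i => [_|i IHi i_lt].
    by rewrite /= /g /b /side xphi -/s /k /corner /f /=; case: (s).
  rewrite iterS IHi ?(ltnW i_lt) // [in RHS]iterS /g /b /side [_.1.1]/=.
  rewrite (negbTE (out_phi _ i_lt)) /k /corner /f /=; by case: (s).
exists n; rewrite ?iterE // inE; split=> // i i_lt.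
by rewrite iterE ?(ltnW i_lt) // inE; apply: out_phi.
Qed.

Lemma fconnect_face_step x y : x \in A -> fconnect F x y = fconnect g x y && (y \in A).
Proof.
move=> xA; apply/idP/andP=> [|[xy yA]].
  move: y; apply: connect_ind => [|y z [xy yA] /eqP <-]; first by rewrite connect0.
  have [n -> [yA' _]] := face_step_return yA; split=> //.
  by apply: connect_trans xy _; apply: fconnect_iter.
rewrite -(iter_findex xy) in yA *; move: (findex g x y) yA => i.
elim/ltn_ind: i x xA {xy} => -[_ x _ _|i IHi x xA iA]; first exact: connect0.
have [n Fx [FxA outA]] := face_step_return xA.
(* The first return cannot come after the visit to [A] at step [i.+1], so it can be split off. *)
case: (ltnP i n) => [/outA|n_le]; first by rewrite iA.
have iE : iter i.+1 g x = iter (i - n) g (F x).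
  by rewrite Fx -iterD addnS subnK.
rewrite iE in iA *; apply: connect_trans (fconnect1 _ _) _.
by apply: IHi => //; rewrite ltnS leq_subr.
Qed.

(** On [A] symmetry is inherited from the injective [g]; off [A] the map [F] is the identity. *)
Lemma face_step_sym : connect_sym (frel F).
Proof.
have sub x y : fconnect F x y -> fconnect F y x.
  case: (boolP (x \in A)) => xA; last first.
    suff xF u : fconnect F x u -> u = x by move=> /xF ->; apply: connect0.
    move: u; apply: connect_ind => // u v -> /eqP <-.
    by move: xA; rewrite /A inE /F /face_step => /negbTE ->.
  rewrite fconnect_face_step // => /andP[xy yA].
  by rewrite fconnect_face_step // xA (fconnect_sym (comp_inj kK bK)) xy.
by move=> x y; apply/idP/idP; apply: sub.
Qed.

Let r_sym : connect_sym r := gen_rel_sym kK bK.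

(** Each orbit meeting [A] in a flag [z] contains exactly two traces, those of [z] and [b z]. They
    are distinct because neither involution has a fixed point. *)
Lemma card_face_step : fcard F A = #|root r @: A|.*2.
Proof.
rewrite /n_comp_mem.
have F_root x : x \in A -> root (frel F) x \in A.
  by move=> xA; have := connect_root (frel F) x; rewrite fconnect_face_step // => /andP[].
have r_root x : x \in A -> root r (root (frel F) x) = root r x.
  move=> xA; apply/esym/eqP; rewrite root_connect //.
  have := connect_root (frel F) x; rewrite fconnect_face_step // => /andP[xg _].
  exact: fconnect_gen_rel.
have fibre c : c \in root r @: A ->
    #|[set x | (x \in [predI froots F & A]) && (root r x == c)]| = 2.
  case/imsetP=> z zA ->; have bzA : b z \in A by rewrite mem_states_side.
  have -> : [set x | (x \in [predI froots F & A]) && (root r x == root r z)]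
          = [set root (frel F) z; root (frel F) (b z)].
    apply/setP=> x; rewrite !inE; apply/idP/idP => [/andP[/andP[/eqP rx xA]]|].
      have xAs : x \in A by rewrite /A inE.
      have xE u : u \in A -> (x == root (frel F) u) = fconnect g u x.
        move=> uA; rewrite -[X in X == _]rx eq_sym root_connect; last exact: face_step_sym.
        by rewrite fconnect_face_step // xAs andbT.
      by rewrite eq_sym root_connect // (connect_gen_rel kK bK) !xE.
    have rb : root r (b z) = root r z.
      by apply/esym/eqP; rewrite root_connect //; apply: gen_rel_r.
    have in_phi u : u \in A -> (root (frel F) u).1.1 \in phi.
      by move=> /F_root; rewrite /A inE.
    by case/orP=> /eqP ->; rewrite (roots_root face_step_sym) /= in_phi ?r_root ?rb ?eqxx.
  rewrite cards2 root_connect; last exact: face_step_sym.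
  rewrite fconnect_face_step // bzA andbT.
  rewrite (fconnect_comp_free kK bK (corner_free (rg_rot G))) // => y _; exact: side_free.
rewrite -[LHS]sum1_card (partition_big (root r) (mem (root r @: A))) /=; last first.
  by move=> x xFA; apply: imset_f; case/andP: xFA.
rewrite (eq_bigr (fun=> 2)) ?sum_nat_const ?muln2 // => c cA.
by rewrite -(fibre c cA) -sum1dep_card.
Qed.

Hypothesis wfG : rg_wf G.

Let isolated := [set v : V | [forall h : E * bool, (h.1 \in phi) ==> (rg_inc G h != v)]].

Lemma inc_corner x : rg_inc G (k x).1 = rg_inc G x.1.
Proof.
have [inc_rot _ _] := wfG.
by case: x => h [] /=; rewrite /k /corner /= ?inc_rot // -[in RHS](permKV (rg_rot G) h) inc_rot.
Qed.

Lemma ex_end_at (e0 : E) v : exists h, rg_inc G h = v.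
Proof.
have [_ _ conn] := wfG.
have /connectP[[/= _ <-|w p /= /andP[]]] := conn v (rg_inc G (e0, false)).
  by exists (e0, false).
by case/existsP=> e /orP[]/andP[/eqP ? /eqP ?] _ _; [exists (e, false)|exists (e, true)].
Qed.

Lemma isolated_closed v x y : v \in isolated -> rg_inc G x.1 = v -> connect r x y ->
  rg_inc G y.1 = v.
Proof.
rewrite inE => /forallP v_iso xv; move: y; apply: connect_ind => // y z yv.
case/orP=> /eqP ->; rewrite ?inc_corner // /b /side; case: ifP => //= yphi.
by have := v_iso y.1; rewrite yphi yv eqxx.
Qed.

(** Turning around the vertex, [k] and [b] pass every end outside [phi], so either an end of [phi]
    is met or all flags at the vertex are reached. *)
Lemma connect_around x h d : rg_inc G h = rg_inc G x.1 ->
  (exists2 z, z \in A & connect r x z) \/ connect r x (h, d).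
Proof.
have [_ rot_conn _] := wfG => /esym /rot_conn; move: h d.
have flip h d : h.1 \notin phi -> connect r x (h, d) -> forall d', connect r x (h, d').
  move=> hphi xh d'; case: (eqVneq d' d) => [-> //|d'd].
  apply: connect_trans xh _.
  have -> : (h, d') = b (h, d) by rewrite /b /side (negbTE hphi); case: d d' d'd => [] [].
  exact: gen_rel_r.
suff step h : fconnect (rg_rot G) x.1 h ->
    (exists2 z, z \in A & connect r x z) \/ forall d, connect r x (h, d).
  by move=> h d /step [|all_d]; [left|right].
move: h; apply: connect_ind => [|h h' [zA|all_d] /eqP <-]; [|by left|].
  case: (boolP (x.1.1 \in phi)) => xphi; first by left; exists x; rewrite ?inE ?connect0.
  by right; apply: (flip _ x.2) => //; rewrite -surjective_pairing connect0.
have xk : connect r x (rg_rot G h, false).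
  exact: connect_trans (all_d true) (gen_rel_l _ _ _).
case: (boolP ((rg_rot G h).1 \in phi)) => hphi; last by right; apply: flip xk.
by left; exists (rg_rot G h, false); rewrite ?inE.
Qed.

Lemma n_boundaryE : n_boundary G phi = #|isolated| + #|root r @: A|.
Proof. by rewrite /n_boundary card_face_step doubleK. Qed.

(** The edge [e0] provides flags and, by connectedness of the graph, an end at every vertex, so that
    isolated vertices also appear as orbits. *)
Lemma feasible_transitive2 (e0 : E) : (phi \in feasible G) = transitive2 k b.
Proof.
rewrite inE n_boundaryE.
case: (set_0Vmem A) => [A0 | [z zA]].
  have in_iso v : v \in isolated.
    rewrite inE; apply/forallP=> h; apply/implyP=> hphi.
    by have := in_set0 (h, true); rewrite -A0 inE hphi.
  rewrite A0 imset0 cards0 addn0; apply/cards1P/forallP=> [[v isoE] x|tr].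
    apply/forallP=> -[h d]; have incE u : u = v by apply/set1P; rewrite -isoE in_iso.
    have [|[u]|//] := @connect_around x h d; first by rewrite (incE (rg_inc _ _)) [RHS]incE.
    by rewrite A0 inE.
  exists (rg_inc G (e0, true)); apply/setP=> v; rewrite in_iso inE; apply/esym/eqP.
  have [h hv] := ex_end_at e0 v.
  by apply/esym; have := isolated_closed (x := (h, true)) (in_iso v) hv
       (forallP (tr (h, true)) (e0, true, true)).
(* With an edge in [phi] some component is traced, so a count of one excludes isolated vertices;
   then every flag is connected to [A]. *)
have rootA_gt0 : 0 < #|root r @: A| by apply/card_gt0P; exists (root r z); apply: imset_f.
apply/idP/forallP=> [|tr].
  case: (posnP #|isolated|) => [iso0|]; last first.
    by move: rootA_gt0; case: #|_| => // n _; case: #|_| => // m; rewrite addnS.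
  rewrite iso0 add0n => /cards1P[c rootA] x.
  suff rootE u : root r u = c by apply/forallP=> y; rewrite -root_connect // !rootE.
  have reach : exists2 w, w \in A & connect r u w.
    have : rg_inc G u.1 \notin isolated by rewrite (cards0_eq iso0) inE.
    rewrite inE negb_forall => /existsP[h]; rewrite negb_imply negbK.
    case/andP=> hphi /eqP /(@connect_around u h true) [//|uh].
    by exists (h, true); rewrite ?inE.
  have [w wA] := reach; rewrite -root_connect // => /eqP ->.
  by apply/set1P; rewrite -rootA imset_f.
have -> : #|root r @: A| = 1.
  apply/eqP/cards1P; exists (root r z); apply/setP=> c; rewrite inE.
  apply/imsetP/eqP=> [[u _ ->]|->]; last by exists z.
  by apply/eqP; rewrite root_connect //; apply: (forallP (tr u)).
rewrite addn1 eqSS cards_eq0; apply/eqP/setP=> v; rewrite [RHS]inE.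
apply/negP=> v_iso; have [h hv] := ex_end_at e0 v.
have := isolated_closed (x := (h, true)) v_iso hv (forallP (tr (h, true)) z).
move: v_iso; rewrite inE => /forallP/(_ z.1); move: zA; rewrite inE => -> /= /eqP.
by [].
Qed.

End FaceCount.

(** * The exchange on flags *)

Lemma transitive2_map (T : finType) (f k b k' b' : T -> T) : involutive f ->
  (forall x, k' (f x) = f (k x)) -> (forall x, b' (f x) = f (b x)) ->
  transitive2 k b -> transitive2 k' b'.
Proof.
move=> fK kE bE /forallP tr.
have map x y : connect (gen_rel k b) x y -> connect (gen_rel k' b') (f x) (f y).
  move: y; apply: connect_ind => // y z xy /orP[] /eqP ->; apply: connect_trans xy _.
    by rewrite -kE; apply: gen_rel_l.
  by rewrite -bE; apply: gen_rel_r.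
apply/forallP=> x; apply/forallP=> y; rewrite -[x]fK -[y]fK.
exact: map (forallP (tr (f x)) (f y)).
Qed.

Lemma octet_sideK p tw : involutive (octet_side p tw).
Proof.
case=> [[c t] d]; rewrite /octet_side; case pc: (p c); rewrite /= pc negbK //.
by case: d; case: (tw c).
Qed.

Lemma octet_swapK : involutive octet_swap.
Proof. by case=> [[[] []] []]. Qed.

Section Exchange.

Variables (E : finType) (rot : {perm (E * bool)}) (tw : E -> bool) (phi : {set E}).
Variables (ha hb : E * bool).
Hypotheses (neq_ab : ha.1 != hb.1) (rot_ha : rot ha = hb).

Let D := [set ha.1; hb.1].

Definition swap_ends (x : (E * bool) * bool) : (E * bool) * bool := (tperm ha hb x.1, x.2).

Lemma swap_endsK : involutive swap_ends.
Proof. by case=> h d; rewrite /swap_ends /= tpermK. Qed.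

Lemma swap_ends_off x : x.1.1 \notin D -> swap_ends x = x.
Proof.
case: x => h d; rewrite !inE negb_or /= => /andP[ha_h hb_h].
rewrite /swap_ends /= tpermD //.
  by apply: contraNneq ha_h => ->.
by apply: contraNneq hb_h => ->.
Qed.

Definition octet_flag (x : bool * bool * bool) : (E * bool) * bool :=
  let: (c, t, d) := x in
  let h := if c then hb else ha in (if t then opp_end h else h, d).

Lemma octet_flag_inj : injective octet_flag.
Proof.
have neq_ba : hb.1 != ha.1 by rewrite eq_sym.
move: neq_ab neq_ba; rewrite /octet_flag /opp_end; case: ha hb => [a s] [b u] /= ab ba.
case=> [[c t] d] [[c' t'] d'] /eqP; rewrite -pair_eqE /= => /andP[h /eqP ->].
by move: h; case: c; case: c'; case: t; case: t' => //=;
  rewrite -pair_eqE /= ?(negbTE ab) ?(negbTE ba) ?eqxx //=; case: s; case: u.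
Qed.

Lemma octet_flag_surj x : x.1.1 \in D -> exists i, x = octet_flag i.
Proof.
case: x => [[e s] d]; rewrite !inE /=; case/orP=> /eqP ->.
  exists (false, s != ha.2, d); rewrite /octet_flag /opp_end /=.
  by case: (ha) s => [? []] [].
exists (true, s != hb.2, d); rewrite /octet_flag /opp_end /=.
by case: (hb) s => [? []] [].
Qed.

Lemma octet_flag_in i : (octet_flag i).1.1 \in D.
Proof. by case: i => [[[] []] d]; rewrite !inE eqxx ?orbT. Qed.

Lemma octet_flag_off x : (forall i, x != octet_flag i) -> x.1.1 \notin D.
Proof.
by move=> off; apply/negP=> /octet_flag_surj[i xE]; have := off i; rewrite xE eqxx.
Qed.

Let edge (c : bool) : E := if c then hb.1 else ha.1.

Lemma side_octet_flag psi i :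
  side psi tw (octet_flag i) = octet_flag (octet_side (fun c => edge c \in psi) (tw \o edge) i).
Proof.
case: i => [[c t] d]; rewrite /octet_flag /octet_side /side /edge /=.
by case: c; case: t => /=; case: ifP => // _; rewrite /opp_end /= negbK -surjective_pairing.
Qed.

Lemma swap_octet_flag i : swap_ends (octet_flag i) = octet_flag (octet_swap i).
Proof.
case: i => [[c t] d]; rewrite /swap_ends /octet_flag /=; case: t => /=.
  rewrite addbF; case: c; rewrite tpermD //; apply/eqP.
  - by move/(congr1 fst)/eqP; apply/negP.
  - by case: (hb) => e [].
  - by case: (ha) => e [].
  - by move/(congr1 fst)/eqP; apply/negP; rewrite eq_sym.
by case: c => /=; rewrite ?tpermL ?tpermR.
Qed.

Let k := corner rot.
Let bs x := if x.1.1 \in D then x else side phi tw x.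
Let p c := edge c \in phi.

Let m := mate_index k bs octet_flag.

Let bsK : involutive bs.
Proof.
rewrite /bs => x; case: (boolP (x.1.1 \in D)) => xD; rewrite ?xD //.
by rewrite side_edge (negbTE xD) sideK.
Qed.

Let bs_in i : bs (octet_flag i) = octet_flag i.
Proof. by rewrite /bs octet_flag_in. Qed.

Let bs_fixed x : bs x = x -> exists i, x = octet_flag i.
Proof.
rewrite /bs; case: ifP => [xD _|_ /eqP]; first exact: octet_flag_surj.
by rewrite (negbTE (side_free phi tw x)).
Qed.

Lemma transitive2_octet b b' : involutive b ->
  (forall i, b (octet_flag i) = octet_flag (b' i)) ->
  (forall x, x.1.1 \notin D -> b x = side phi tw x) ->
  transitive2 k b = [forall x, exists i, connect (gen_rel k bs) x (octet_flag i)]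
                    && transitive2 m b'.
Proof.
move=> bK b_in b_off.
apply: (transitive2_reduction (cornerK rot) (corner_free rot) bsK octet_flag_inj) => //.
  by move=> x /octet_flag_off xD; rewrite b_off // /bs (negbTE xD).
exact: octet0.
Qed.

(** The corner between [ha] and [hb] is a path of a single step of [k], both of its ends being fixed
    by [bs]. *)
Lemma mate_index_corner : m (false, false, true) = (true, false, false).
Proof.
have kE : k (octet_flag (false, false, true)) = octet_flag (true, false, false).
  by rewrite /k /corner /= rot_ha.
have := fixed_point_mate (cornerK rot) bsK (bs_in (false, false, true))
  (bs_in (true, false, false)).
rewrite -kE gen_rel_l kE => /(_ isT).
rewrite -(mate_indexE (cornerK rot) (corner_free rot) bsK bs_in bs_fixed).
by rewrite !(inj_eq octet_flag_inj) /= => /eqP.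
Qed.

Lemma transitive2_exchange :
  transitive2 k (swap_ends \o side phi tw \o swap_ends) =
  transitive2 k (side phi tw)
  (+) [&& ha.1 \in phi, hb.1 \in phi & transitive2 k (side (phi :\: D) tw)].
Proof.
have mK : involutive m.
  exact: mate_indexK (cornerK rot) (corner_free rot) bsK octet_flag_inj bs_in bs_fixed.
have m_free x : m x != x.
  exact: mate_index_free (cornerK rot) (corner_free rot) bsK octet_flag_inj bs_in bs_fixed x.
have swapK p' : involutive (octet_swap \o octet_side p' (tw \o edge) \o octet_swap).
  by move=> x /=; rewrite octet_swapK octet_sideK octet_swapK.
have edge_off c : (edge c \in phi :\: D) = false.
  by rewrite !inE /edge; case: c; rewrite eqxx ?orbT.
rewrite (transitive2_octet (sideK phi tw) (side_octet_flag phi)) //.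
rewrite (@transitive2_octet _ (octet_side xpred0 (tw \o edge)) (sideK _ tw)); first last.
- move=> x xD; rewrite /side inE xD //.
- move=> i; rewrite side_octet_flag; case: i => [[c t] d].
  by rewrite /octet_side edge_off.
rewrite (@transitive2_octet _ (octet_swap \o octet_side p (tw \o edge) \o octet_swap)); first last.
- move=> x xD /=; by rewrite (swap_ends_off xD) swap_ends_off // side_edge.
- by move=> i /=; rewrite swap_octet_flag side_octet_flag swap_octet_flag.
- by move=> x /=; rewrite swap_endsK sideK swap_endsK.
have /and4P[w0 w1 w2 /eqP par] := exchange_parityP p (tw \o edge) mK m_free mate_index_corner.
rewrite !transitive2_walk //; try exact: octet_sideK.
move: par; rewrite -[ha.1 \in phi]/(p false) -[hb.1 \in phi]/(p true) -/p.
(* If some orbit of [k] and [bs] misses the 8 sides, all three transitivity terms are false;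
   otherwise the check on [m] concludes. *)
case: [forall x, _] => /=; last by rewrite !andbF.
by move=> <-; rewrite addKb.
Qed.

End Exchange.

(** * The exchange on ribbon graphs *)

Section ExchangeGraph.

Variables (V E : finType) (G : ribbon_graph V E) (ha hb : E * bool).
Hypotheses (wfG : rg_wf G) (neq_ab : ha.1 != hb.1) (rot_ha : rg_rot G ha = hb).

Lemma exchange_rotE h :
  rg_rot (exchange_ends G ha hb) (tperm ha hb h) = tperm ha hb (rg_rot G h).
Proof. exact: permJ. Qed.

Lemma inc_tperm h : rg_inc G (tperm ha hb h) = rg_inc G h.
Proof.
have [inc_rot _ _] := wfG; have inc_ab : rg_inc G hb = rg_inc G ha by rewrite -rot_ha.
by case: tpermP => // ->.
Qed.

Lemma exchange_wf : rg_wf (exchange_ends G ha hb).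
Proof.
have [inc_rot rot_conn conn] := wfG; split=> // [h | h h' hh'].
  rewrite -[h in LHS](tpermK ha hb) exchange_rotE /= inc_tperm inc_rot.
  exact: inc_tperm.
have := rot_conn (tperm ha hb h) (tperm ha hb h').
rewrite !inc_tperm => /(_ hh'); rewrite -[h' in X in _ -> X](tpermK ha hb).
move: (tperm ha hb h'); apply: connect_ind => [|u v hu /eqP <-].
  by rewrite tpermK connect0.
by apply: connect_trans hu _; rewrite -exchange_rotE fconnect1.
Qed.

(** Conjugating by the swap of the two ends restores the rotation of [G] and moves the change into
    the side involution, as in [transitive2_exchange]. *)
Lemma feasible_exchange phi : (phi \in feasible (exchange_ends G ha hb)) =
  (phi \in feasible G) (+)
  [&& ha.1 \in phi, hb.1 \in phi & phi :\: [set ha.1; hb.1] \in feasible G].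
Proof.
rewrite [LHS](feasible_transitive2 phi exchange_wf ha.1).
rewrite (feasible_transitive2 phi wfG ha.1) (feasible_transitive2 (phi :\: _) wfG ha.1).
rewrite -(transitive2_exchange (rg_tw G) phi neq_ab rot_ha).
have cE x : corner (rg_rot (exchange_ends G ha hb)) (swap_ends ha hb x)
            = swap_ends ha hb (corner (rg_rot G) x).
  case: x => h []; rewrite /corner /swap_ends /= ?permJ //.
  by rewrite -conjVg permJ.
have swK := swap_endsK ha hb.
apply/idP/idP; apply: (transitive2_map swK) => x //=.
- by rewrite -{2}[x]swK cE swK.
- by rewrite swK.
Qed.

End ExchangeGraph.

(** * Twists and slides of set systems *)

Section SetSystem.

Variables (E : finType) (Phi : {set {set E}}).

Lemma in_symdiff (T : finType) (A B : {set T}) x :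
  (x \in symdiff A B) = (x \in A) (+) (x \in B).
Proof. by rewrite !inE; case: (x \in A); case: (x \in B). Qed.

Lemma symdiffK (X : {set E}) : involutive (fun A => symdiff A X).
Proof. by move=> A; apply/setP=> x; rewrite !in_symdiff addbK. Qed.

Lemma in_ss_twist (Psi : {set {set E}}) X A :
  (A \in ss_twist Psi X) = (symdiff A X \in Psi).
Proof.
apply/imsetP/idP => [[B BPsi ->]|APsi]; first by rewrite symdiffK.
by exists (symdiff A X); rewrite ?symdiffK.
Qed.

Lemma in_ss_slide (Psi : {set {set E}}) a b A : a != b ->
  (A \in ss_slide Psi a b) =
  (A \in Psi) (+) [&& a \in A, b \notin A & b |: A :\ a \in Psi].
Proof.
move=> ab; rewrite in_symdiff; congr addb.
apply/imsetP/and3P=> [[B]|[aA bA APsi]].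
  rewrite inE => /andP[/subsetP Bsub BPsi] ->.
  have aB : a \notin B by apply/negP=> /Bsub; rewrite !inE eqxx.
  have bB : b \notin B by apply/negP=> /Bsub; rewrite !inE eqxx orbT.
  rewrite !inE eqxx orbT negb_or bB eq_sym ab; split=> //.
  suff -> : (B :|: [set a]) :\ a = B by rewrite setUC.
  by rewrite setUC setU1K.
exists (A :\ a); last by rewrite setUC setD1K.
rewrite inE (setUC (A :\ a)) APsi andbT; apply/subsetP=> x; rewrite !inE negb_or => /andP[-> xA].
by apply: contraNneq bA => <-.
Qed.

(** The twist turns the slide's condition [b] not in the set into [b \in A], and twisting its
    partner set back removes [b], leaving [A] without [a] and [b]. *)
Lemma in_ss_prime a b A : a != b ->
  (A \in ss_prime Phi a b) =
  (A \in Phi) (+) [&& a \in A, b \in A & A :\: [set a; b] \in Phi].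
Proof.
move=> ab; rewrite in_ss_twist in_ss_slide // !in_ss_twist symdiffK; congr addb.
rewrite !in_symdiff !inE (negbTE ab) eqxx addbF addbT negbK.
case: (a \in A) => //=; case bA: (b \in A) => //=.
have -> // : symdiff (b |: symdiff A [set b] :\ a) [set b] = A :\: [set a; b].
apply/setP=> x; rewrite !(in_symdiff, inE).
case: (eqVneq x b) => [->|] /=; first by rewrite orbT.
by case: (x == a); rewrite ?addbF.
Qed.

End SetSystem.

Theorem theorem4p3 (V E : finType) (G : ribbon_graph V E) (a b : E)
    (ha hb : E * bool) :
  rg_wf G -> a != b -> ha.1 = a -> hb.1 = b ->
  (rg_rot G ha = hb \/ rg_rot G hb = ha) ->
  feasible (exchange_ends G ha hb) = ss_prime (feasible G) a b.
Proof.
move=> wfG ab haE hbE; rewrite -haE -hbE in ab *.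
case=> rot_h; apply/setP=> phi; rewrite in_ss_prime //; first exact: feasible_exchange.
(* When [hb] precedes [ha], the roles are swapped: the transposition and the membership formula are
   symmetric in the two ends. *)
rewrite /exchange_ends tpermC -/(exchange_ends G hb ha).
have neq_ba : hb.1 != ha.1 by rewrite eq_sym.
rewrite [LHS](feasible_exchange wfG neq_ba rot_h).
by rewrite setUC andbCA.
Qed.
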